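(* For every congruence $R$ on a monoid $M$, the equivalence class $[1]_R$ of the identity element is a normal submonoid of $M$.
   Context: A congruence on a monoid $M$ is an equivalence relation $R\subseteq M\times M$ compatible with the product. For a monoid $M$ with identity $1$, $U(M)$ denotes its group of units (elements with a two-sided inverse). A groupal submonoid of $M$ is a submonoid $S\subseteq M$ such that $x^{-1}\in S$ for every $x\in S\cap U(M)$. For $A\subseteq M$ and $x,y\in M$, $xAy=\{xay : a\in A\}$. A subset $A\subseteq M$ is invariant if for each $x,y\in M$ the following three conditions are equivalent: (i) $xAy\subseteq A$; (ii) $xy\in A$; (iii) $(xAy)\cap A\neq\emptyset$. A normal submonoid of $M$ is a submonoid which is both groupal and invariant. *)

(* Defs.v *)
From Stdlib Require Import RelationClasses.
From mathcomp Require Import all_boot.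
From mathcomp Require Import boolp classical_sets.

Set Implicit Arguments.
Unset Strict Implicit.
Unset Printing Implicit Defensive.

Local Open Scope classical_set_scope.
Local Open Scope group_scope.

(* MathComp's [monoidType] carries a choice structure; classically (see [boolp])
   this is no restriction on the underlying set. *)

Definition congruence (M : monoidType) (R : M -> M -> Prop) : Prop :=
  Equivalence R /\
  forall x x' y y' : M, R x x' -> R y y' -> R (x * y) (x' * y').

Definition eq_class (T : Type) (R : T -> T -> Prop) (a : T) : set T :=
  [set x | R a x].

Definition is_inverse (M : monoidType) (x y : M) : Prop :=
  x * y = 1 /\ y * x = 1.

Definition units (M : monoidType) : set M := [set x | exists y, is_inverse x y].

Lemma is_inverse_unique (M : monoidType) (x y z : M) :
  is_inverse x y -> is_inverse x z -> y = z.
Proof. by move=> [_ yx] [xz _]; rewrite -[y]mulg1 -xz mulgA yx mul1g. Qed.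

Definition submonoid (M : monoidType) (S : set M) : Prop :=
  S 1 /\ forall x y : M, S x -> S y -> S (x * y).

(* A monoidType has no inversion operator: the inverse of a unit [x] is the [y]
   with [is_inverse x y], unique by [is_inverse_unique]. *)
Definition groupal_submonoid (M : monoidType) (S : set M) : Prop :=
  submonoid S /\
  forall x : M, (S `&` @units M) x -> forall y : M, is_inverse x y -> S y.

Definition sandwich (M : monoidType) (x : M) (A : set M) (y : M) : set M :=
  [set x * a * y | a in A].

Definition invariant_set (M : monoidType) (A : set M) : Prop :=
  forall x y : M,
    [<-> sandwich x A y `<=` A; A (x * y); sandwich x A y `&` A !=set0].

Definition normal_submonoid (M : monoidType) (S : set M) : Prop :=
  groupal_submonoid S /\ invariant_set S.

(* Main.v *)
Require Import Defs.
From mathcomp Require Import all_boot.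

(** If [a] is congruent to [1], then [x * a * y] is congruent to [x * y]. So every element of
    [sandwich x A y], with [A] the class of [1], lies in the single class of [x * y]: one of them is
    in [A] iff all are, iff [x * y] is. This is invariance; the submonoid and groupal parts come
    from compatibility with products. *)

Lemma congruence_sandwich (M : monoidType) (R : M -> M -> Prop) (x a y : M) :
  congruence R -> R 1%g a -> R (x * y)%g (x * a * y)%g.
Proof.
move=> [[refl _ _] comp] Ra.
by rewrite -{1}(mulg1 x); apply: (comp) => //; apply: comp.
Qed.

Theorem proposition3p5 (M : monoidType) (R : M -> M -> Prop) :
  congruence R -> normal_submonoid (eq_class R 1%g).
Proof.
move=> congR; have [[refl sym trans] comp] := congR.
have sandwichR x a y := @congruence_sandwich M R x a y congR.
split; first split; first split.
- exact: refl.
- by move=> x y Rx Ry; rewrite /eq_class /= -(mulg1 1%g); apply: comp.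
(* Multiplying [R 1 x] on the right by [y] relates [y] to [x * y = 1]. *)
- move=> x [Rx _] y [xy _]; rewrite /eq_class /=.
  by apply: sym; rewrite -xy -{1}(mul1g y); apply: comp.
(* The conditions are proved in a cycle; the first two implications use [1] as the middle factor. *)
move=> x y; tfae.
- by move=> sub; rewrite -(mulg1 x); apply: sub; exists 1%g => //; apply: refl.
- by move=> Rxy; exists (x * 1 * y)%g; split;
    [exists 1%g => //; apply: refl | rewrite mulg1].
(* The chain is [1], [x * a * y], [x * y], [x * b * y]. *)
- move=> [_ [[a Ra <-] Rxay]] _ [b Rb <-].
  apply: (trans _ _ _ _ (sandwichR x b y Rb)).
  by apply: (trans _ _ _ Rxay); apply: sym; apply: sandwichR.
Qed.
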